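(* Let $m,s\ge1$ and let $n_{ip}\ge1$ be integers ($1\le i\le s$, $1\le p\le m$). For each $p$ let $A^p=(A^p_{ij})_{i,j=1}^s$ be a positive definite complex matrix partitioned into blocks $A^p_{ij}\in M_{n_{ip},n_{jp}}(\mathbb{C})$ (so diagonal blocks are square). Put $\sigma_{ip}=n_{ip}^{-1}\prod_{q=1}^mn_{iq}$ and $A=\bigodot_{p=1}^mA^p$. Then for each $i=1,\dots,s$, $$\frac{|(A)_i|}{|(A)_{i-1}|}\ \ge\ \prod_{p=1}^m|A^p_{ii}|^{\sigma_{ip}}-\prod_{p=1}^m\Bigl\{|A^p_{ii}|^{\sigma_{ip}}-\Bigl(\frac{|(A^p)_i|}{|(A^p)_{i-1}|}\Bigr)^{\sigma_{ip}}\Bigr\}.$$ Equality holds if and only if one of the following holds: (a) $m=1$ or $i=1$; (b) there exists $p$ such that $A^p_{li}=0$ and $A^p_{il}=0$ for every $l<i$; (c) $n_{ip}=1$ for every $p$, and there exists $i_0<i$ such that $A^p_{li}=A^p_{li_0}(A^p_{i_0i_0})^{-1}A^p_{i_0i}$ for every $l<i$ and every $p$.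
   Context: $|X|$ denotes the determinant. For block matrices $A^p=(A^p_{ij})_{i,j=1}^s$ the Hadamard (Khatri–Rao) product is $\bigodot_{p=1}^mA^p=(A^1_{ij}\otimes\cdots\otimes A^m_{ij})_{i,j=1}^s$ ($\otimes$ = Kronecker product). For a block matrix $X=(X_{jk})_{j,k=1}^s$, $(X)_i=(X_{jk})_{j,k=1}^i$ is its $i$-th leading principal block submatrix, with the convention $|(X)_0|=1$. *)

(* Defs.v *)
From HB Require Import structures.
From mathcomp Require Import all_boot all_order all_algebra.
From mathcomp Require Import reals.
From mathcomp.real_closed Require Import complex mxtens.
Set Implicit Arguments. Unset Strict Implicit. Unset Printing Implicit Defensive.
Import Order.TTheory GRing.Theory Num.Theory.
Local Open Scope ring_scope.

Definition ctmx (C : numClosedFieldType) m n (A : 'M[C]_(m, n)) : 'M[C]_(n, m) :=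
  map_mx Num.conj (A^T).

Definition posdefmx (C : numClosedFieldType) N (A : 'M[C]_N) : Prop :=
  ctmx A = A /\ forall x : 'rV[C]_N, x != 0 -> 0 < (x *m A *m ctmx x) 0 0.

(* leading principal block submatrix (X)_k = (X_{jl})_{j,l < k} of a block
   matrix given by its blocks B j l : 'M_(N j, N l) (0-based block indices). *)
Definition leadmx (C : nzRingType) (N : nat -> nat) (B : forall j l, 'M[C]_(N j, N l))
  (k : nat) : 'M[C]_(\sum_(j < k) N j) :=
  \mxblock_(j < k, l < k) B j l.

(* iterated Kronecker product of the (j,l) blocks of A^0, ..., A^(k-1):
   A^0_{jl} (x) A^1_{jl} (x) ... (x) A^(k-1)_{jl}; n j p is the size of block j of A^p *)
Fixpoint kdim (n : nat -> nat -> nat) (j k : nat) : nat :=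
  match k with 0 => 1%N | k'.+1 => (kdim n j k' * n j k')%N end.

Fixpoint kron_blk (C : comNzRingType) (n : nat -> nat -> nat)
  (Ab : forall p j l, 'M[C]_(n j p, n l p)) (j l k : nat)
  : 'M[C]_(kdim n j k, kdim n l k) :=
  match k return 'M[C]_(kdim n j k, kdim n l k) with
  | 0 => (1%:M : 'M[C]_1)
  | k'.+1 => kron_blk Ab j l k' *t Ab k' j l
  end.

Definition khatri_rao (C : comNzRingType) (n : nat -> nat -> nat)
  (Ab : forall p j l, 'M[C]_(n j p, n l p)) (m : nat) :
  forall j l, 'M[C]_(kdim n j m, kdim n l m) :=
  fun j l => kron_blk Ab j l m.

(* Main.v *)
Require Import Defs.
From HB Require Import structures.
From mathcomp Require Import all_boot all_order all_algebra.
From mathcomp Require Import reals.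
From mathcomp.real_closed Require Import complex mxtens.
From mathcomp Require Import ring boolp.
Import Order.TTheory GRing.Theory Num.Theory.
Local Open Scope ring_scope.
Set Implicit Arguments. Unset Strict Implicit. Unset Printing Implicit Defensive.

(** Factor each positive definite [A^p] as a Gram matrix, [A^p_jl = G^p_j (G^p_l)^*]
    with linearly independent rows.  The ratio [|(A^p)_i| / |(A^p)_(i-1)|] is the
    Gram determinant of the residual of [G^p_i] after orthogonal projection, with
    image [H^p], onto the rows of the [G^p_l], [l < i].  The Khatri-Rao product is
    the Gram matrix of the frames [G_j = (x)_p G^p_j].  The part of [G_i] orthogonal
    to [W = (x)_p H^p] is orthogonal to every [G_l], [l < i], so the Gram matrix of
    the residual of [G_i] is [(x)_p A^p_ii - (x)_p H^p (H^p)^*] plus a positive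
    semidefinite term that vanishes iff [W] lies in the span of the [G_l].

    Diagonalising [A^p_ii] and [H^p (H^p)^*] simultaneously reduces the determinant
    bound to a scalar inequality between products over the entries of the tensor
    diagonal, which is strict as soon as every [H^p] is nonzero, [m > 1] and some
    [n_ip > 1].  When all [n_ip = 1], linear independence shows that the elementary
    tensor [W] is in the span of the diagonal tensors [G_l] only if all the [H^p]
    are supported on one common block [i0]. *)

(** * Block matrices *)

Section LeadingBlocks.
Variables (N : nat -> nat) (k : nat).

Lemma mxsize_recr : (\sum_(j < k) N j + N k = \sum_(j < k.+1) N j)%N.
Proof. by rewrite big_ord_recr. Qed.

Lemma tagnat_Rank_nat (i : 'I_k) (b : 'I_(N i)) :
  @tagnat.Rank k (fun j : 'I_k => N j) i b = (\sum_(j < i) N j + b)%N :> nat.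
Proof. by rewrite [LHS]tagnat.RankEsum (big_ord_widen k) // ltnW. Qed.

End LeadingBlocks.

(** The two sides are compared block by block: by [tagnat_Rank_nat], the flattened position of an
    entry tells whether it lies before or after the offset of the last block. *)
Lemma mxrow_recr (T : Type) (N : nat -> nat) k n (B : forall j, 'M[T]_(n, N j)) :
  \mxrow_(j < k.+1) B j =
  castmx (erefl, mxsize_recr N k) (row_mx (\mxrow_(j < k) B j) (B k)).
Proof.
apply/mxrowP => i; rewrite mxrowK; apply/matrixP => a b.
rewrite !(castmxE, mxE) /= cast_ord_id.
case: splitP => l /= e; have {}e := etrans (esym (tagnat_Rank_nat b)) e.
  have lti : (i < k)%N.
    rewrite ltnNge; apply/negP => leki; have := ltn_ord l.
    have ik : i = k :> nat by apply/eqP; rewrite eqn_leq leki -ltnS ltn_ord.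
    have sk : (\sum_(j < i) N j = \sum_(j < k) N j)%N by rewrite ik.
    by rewrite -e sk ltnNge leq_addr.
  pose i' := Ordinal lti.
  have -> : l = @tagnat.Rank k (fun j : 'I_k => N j) i' b.
    by apply/val_inj; rewrite -[LHS]e; apply/esym; exact: (@tagnat_Rank_nat N k i' b).
  by have /matrixP/(_ a b) := mxrowK (fun j : 'I_k => B j) i'; rewrite mxE => ->.
have [lti|] := ltnP i k; last first.
  move=> leki; have ik : i = k :> nat by apply/eqP; rewrite eqn_leq leki -ltnS ltn_ord.
  case: i {leki} ik b e => i' /= lti ik; case: k / ik l lti => l _ b /eqP.
  by rewrite eqn_add2l => /eqP/val_inj ->.
have : (\sum_(j < i) N j + b < \sum_(j < k) N j)%N.
  have := ltn_ord (@tagnat.Rank k (fun j : 'I_k => N j) (Ordinal lti) b).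
  by rewrite tagnat_Rank_nat.
by rewrite e ltnNge leq_addr.
Qed.

Lemma mxcol_recr (T : Type) (N : nat -> nat) k n (B : forall j, 'M[T]_(N j, n)) :
  \mxcol_(j < k.+1) B j =
  castmx (mxsize_recr N k, erefl) (col_mx (\mxcol_(j < k) B j) (B k)).
Proof.
apply: trmx_inj; rewrite trmx_cast tr_col_mx !tr_mxcol /=.
exact: (mxrow_recr _ (fun j => (B j)^T)).
Qed.

Lemma leadmx_recr (C : nzRingType) (N : nat -> nat)
    (B : forall j l, 'M[C]_(N j, N l)) k :
  leadmx B k.+1 = castmx (mxsize_recr N k, mxsize_recr N k)
    (block_mx (leadmx B k) (\mxcol_(j < k) B j k) (\mxrow_(l < k) B k l) (B k k)).
Proof.
rewrite /leadmx mxblockEh (mxrow_recr _ (fun l => \mxcol_(j < k.+1) B j l)).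
rewrite (mxcol_recr _ (fun j => B j k)).
have -> : \mxrow_(j < k) \mxcol_(j0 < k.+1) B j0 j =
   castmx (mxsize_recr N k, erefl) (col_mx (leadmx B k) (\mxrow_(l < k) B k l)).
  by rewrite -mxblockEh mxblockEv (mxcol_recr _ (fun j => \mxrow_(l < k) B j l)) -mxblockEv.
rewrite -cast_row_mx -block_mxEh castmx_comp; exact: eq_castmx.
Qed.

Lemma det_castmx (C : comNzRingType) n n' (e : n = n') (A : 'M[C]_n) :
  \det (castmx (e, e) A) = \det A.
Proof. by case: n' / e. Qed.

(** Block elimination: subtracting the [w]-combination of the earlier block rows clears the last row
    and leaves a Schur complement in the corner. Giving [w] as data avoids inverting
    [leadmx B k]. *)
Lemma det_leadmx_recr (C : comNzRingType) (N : nat -> nat)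
    (B : forall j l, 'M[C]_(N j, N l)) k (w : forall l, 'M[C]_(N k, N l)) :
  (forall l, (l < k)%N -> B k l = \sum_(j < k) w j *m B j l) ->
  \det (leadmx B k.+1) =
  \det (leadmx B k) * \det (B k k - \sum_(j < k) w j *m B j k).
Proof.
move=> hw; rewrite leadmx_recr det_castmx.
set M := block_mx _ _ _ _; pose W := \mxrow_(j < k) w j.
have WB : W *m leadmx B k = \mxrow_(l < k) B k l.
  by rewrite /W /leadmx mul_mxrow_mxblock; apply: eq_mxrow => l; rewrite hw.
have <- : \det (block_mx 1%:M 0 (- W) 1%:M *m M) = \det M.
  by rewrite det_mulmx det_lblock !det1 !mul1r.
rewrite /M mulmx_block !mul1mx !mul0mx !addr0 !mulNmx WB addNr det_ublock.
by rewrite /W mul_mxrow_mxcol addrC.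
Qed.

(** * Positive matrices *)

Section Adjoint.
Variable C : numClosedFieldType.

Lemma ctmxK m n (A : 'M[C]_(m, n)) : ctmx (ctmx A) = A.
Proof. by apply/matrixP => i j; rewrite !mxE conjCK. Qed.

Lemma ctmxM m n p (A : 'M[C]_(m, n)) (B : 'M[C]_(n, p)) :
  ctmx (A *m B) = ctmx B *m ctmx A.
Proof. by rewrite /ctmx trmx_mul map_mxM. Qed.

Lemma ctmxD m n (A B : 'M[C]_(m, n)) : ctmx (A + B) = ctmx A + ctmx B.
Proof. by rewrite /ctmx linearD /= map_mxD. Qed.

Lemma ctmxB m n (A B : 'M[C]_(m, n)) : ctmx (A - B) = ctmx A - ctmx B.
Proof. by rewrite /ctmx linearB /= map_mxB. Qed.

Lemma ctmx0 m n : ctmx (0 : 'M[C]_(m, n)) = 0.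
Proof. by rewrite /ctmx trmx0 map_mx0. Qed.

Lemma ctmx1 n : ctmx (1%:M : 'M[C]_n) = 1%:M.
Proof. by rewrite /ctmx trmx1 map_mx1. Qed.

Lemma ctmx_sum m n (I : finType) (F : I -> 'M[C]_(m, n)) :
  ctmx (\sum_i F i) = \sum_i ctmx (F i).
Proof. exact: (big_morph _ (@ctmxD m n) (@ctmx0 m n)). Qed.

Lemma ctmx_gram m n (A : 'M[C]_(m, n)) : ctmx (A *m ctmx A) = A *m ctmx A.
Proof. by rewrite ctmxM ctmxK. Qed.

Lemma det_ctmx n (A : 'M[C]_n) : \det (ctmx A) = (\det A)^*.
Proof. by rewrite /ctmx det_map_mx det_tr. Qed.

Lemma unitmx_ctmx n (A : 'M[C]_n) : (ctmx A \in unitmx) = (A \in unitmx).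
Proof. by rewrite !unitmxE det_ctmx !unitfE conjC_eq0. Qed.

Lemma ctmx_diag_real n (d : 'rV[C]_n) :
  (forall k, d 0 k \is Num.real) -> ctmx (diag_mx d) = diag_mx d.
Proof.
move=> dR; apply/matrixP => i j; rewrite !mxE eq_sym; case: eqP => [->|_].
  by rewrite !mulr1n; apply/CrealP.
by rewrite !mulr0n conjC0.
Qed.

Lemma dot_ge0 n (y : 'rV[C]_n) : 0 <= (y *m ctmx y) 0 0.
Proof. by rewrite mxE sumr_ge0 // => k _; rewrite !mxE mul_conjC_ge0. Qed.

Lemma dot_eq0 n (y : 'rV[C]_n) : (y *m ctmx y) 0 0 = 0 -> y = 0.
Proof.
rewrite mxE => /eqP; rewrite psumr_eq0 => [/allP y0|k _]; last first.
  by rewrite !mxE mul_conjC_ge0.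
apply/rowP => k; rewrite mxE; have := y0 k (mem_index_enum _).
by rewrite !mxE mul_conjC_eq0 => /eqP.
Qed.

Lemma row_form n p (P : 'M[C]_(p, n)) (A : 'M[C]_n) k :
  (row k P *m A *m ctmx (row k P)) 0 0 = (P *m A *m ctmx P) k k.
Proof.
by rewrite -row_mul !mxE; apply: eq_bigr => j _; rewrite !mxE.
Qed.

Lemma gram_eq0 m n (A : 'M[C]_(m, n)) : A *m ctmx A = 0 -> A = 0.
Proof.
move=> A0; apply/row_matrixP => k; rewrite row0; apply: dot_eq0.
by have := row_form A 1%:M k; rewrite !mulmx1 A0 [RHS]mxE.
Qed.

Definition psdmx N (A : 'M[C]_N) : Prop :=
  ctmx A = A /\ forall x : 'rV[C]_N, 0 <= (x *m A *m ctmx x) 0 0.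

Lemma psdmx_gram m n (A : 'M[C]_(m, n)) : psdmx (A *m ctmx A).
Proof.
split=> [|x]; first exact: ctmx_gram.
by rewrite mulmxA -mulmxA -ctmxM dot_ge0.
Qed.

Lemma posdefmx_gram m n (A : 'M[C]_(m, n)) (D : 'M[C]_(n, m)) :
  A *m D = 1%:M -> posdefmx (A *m ctmx A).
Proof.
move=> AD; split=> [|x x0]; first exact: ctmx_gram.
rewrite mulmxA -mulmxA -ctmxM lt0r dot_ge0 andbT.
apply: contra x0 => /eqP/dot_eq0 xA0.
by rewrite -[x]mulmx1 -AD mulmxA xA0 mul0mx.
Qed.

Lemma posdefmx_unit n (A : 'M[C]_n) : posdefmx A -> A \in unitmx.
Proof.
move=> [_ A_gt0]; rewrite -row_free_unit -kermx_eq0; apply/eqP/row_matrixP => k.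
rewrite row0; apply/eqP; apply: contraT => /A_gt0.
by rewrite -row_mul mulmx_ker row0 mul0mx mxE ltxx.
Qed.

(** Evaluating the form on the rows of [invmx P] reads off the entries of [d]. *)
Lemma psdmx_diag n (P : 'M[C]_n) (d : 'rV[C]_n) :
  P \in unitmx -> psdmx (P *m diag_mx d *m ctmx P) -> forall k, 0 <= d 0 k.
Proof.
move=> uP [_ psd] k; have := psd (row k (invmx P)).
rewrite row_form !mulmxA mulVmx // mul1mx -mulmxA -ctmxM mulVmx // ctmx1 mulmx1.
by rewrite mxE eqxx mulr1n.
Qed.

Lemma posdefmx_diag n (P : 'M[C]_n) (d : 'rV[C]_n) : P \in unitmx ->
  posdefmx (P *m diag_mx d *m ctmx P) <-> (forall k, 0 < d 0 k).
Proof.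
move=> uP; split=> [[_ pd] k|d_gt0].
  have := pd (row k (invmx P)).
  rewrite row_form !mulmxA mulVmx // mul1mx -mulmxA -ctmxM mulVmx // ctmx1 mulmx1.
  rewrite mxE eqxx mulr1n; apply; apply/negP => /eqP r0.
  have /rowP/(_ k) := congr1 (mulmx^~ P) r0.
  rewrite -row_mul mulVmx // mul0mx !mxE eqxx => /eqP.
  by rewrite oner_eq0.
split=> [|x x0].
  rewrite !ctmxM ctmxK ctmx_diag_real ?mulmxA // => k.
  by rewrite realE ltW.
rewrite !mulmxA -mulmxA -ctmxM; set y := x *m P.
have y0 : y != 0.
  apply: contra x0 => /eqP y0; rewrite -[x](mulmxK uP) -/y y0 mul0mx //.
rewrite lt0r mxE; have Fge0 k : true -> 0 <= (y *m diag_mx d) 0 k * ctmx y k 0.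
  by move=> _; rewrite mul_mx_diag !mxE mulrAC mulr_ge0 ?mul_conjC_ge0 // ltW.
rewrite sumr_ge0 // andbT; apply: contra y0; rewrite psumr_eq0 // => /allP F0.
apply/eqP/rowP => k; have := F0 k (mem_index_enum _).
rewrite mul_mx_diag !mxE mulrAC mulf_eq0 mul_conjC_eq0 [d 0 k == 0]gt_eqF ?orbF //.
by move/eqP.
Qed.

Lemma hermitian_spectral n (A : 'M[C]_n) : ctmx A = A ->
  exists U (d : 'rV[C]_n), U *m ctmx U = 1%:M /\ A = ctmx U *m diag_mx d *m U.
Proof.
move=> hA; have : A \is spectral.normalmx.
  by apply/spectral.normalmxP; change (A *m ctmx A = ctmx A *m A); rewrite hA.
move/spectral.orthomx_spectralP => eA.
have U1 := spectral.spectral_unitarymx A.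
exists (spectral.spectralmx A), (spectral.spectral_diag A).
split; first by move/spectral.unitarymxP: U1.
by rewrite {1}eA spectral.invmx_unitary.
Qed.

Lemma posdefmx_sqrt n (A : 'M[C]_n) : posdefmx A ->
  exists2 Q : 'M[C]_n, Q \in unitmx & A = Q *m ctmx Q.
Proof.
move=> pA; have [U [d [UU eA]]] := hermitian_spectral pA.1.
have [uU _] := mulmx1_unit UU.
have d_gt0 : forall k, 0 < d 0 k.
  apply/(@posdefmx_diag _ (ctmx U)); first by rewrite unitmx_ctmx.
  by rewrite ctmxK -eA.
pose e := \row_k sqrtC (d 0 k).
have eE : A = ctmx U *m diag_mx e *m ctmx (ctmx U *m diag_mx e).
  rewrite ctmxM ctmxK ctmx_diag_real => [|k]; last first.
    by rewrite mxE realE sqrtC_ge0 ltW.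
  rewrite eA !mulmxA; congr (_ *m _); rewrite -!mulmxA; congr (_ *m _).
  rewrite mulmx_diag; congr diag_mx; apply/rowP => k.
  by rewrite !mxE -expr2 sqrtCK.
exists (ctmx U *m diag_mx e) => //.
have := posdefmx_unit pA; rewrite eE.
by rewrite unitmx_mul => /andP[].
Qed.

(** A square root [Q] of [A] reduces to the case where [A] is the identity; the transported matrix
    [Y] is then diagonalised by a unitary, which preserves the identity. *)
Lemma simultaneous_diag n (A X : 'M[C]_n) : posdefmx A -> psdmx X ->
  exists P (x : 'rV[C]_n), [/\ P \in unitmx, A = P *m ctmx P,
    X = P *m diag_mx x *m ctmx P & forall k, 0 <= x 0 k].
Proof.
move=> pA pX; have [Q uQ eA] := posdefmx_sqrt pA.
pose Y := invmx Q *m X *m ctmx (invmx Q).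
have [|U [x [UU eY]]] := @hermitian_spectral _ Y.
  by rewrite !ctmxM ctmxK pX.1 mulmxA.
have [uU _] := mulmx1_unit UU.
have UV : ctmx U *m U = 1%:M by apply: mulmx1C.
have uP : Q *m ctmx U \in unitmx by rewrite unitmx_mul uQ unitmx_ctmx.
have eX : X = Q *m ctmx U *m diag_mx x *m ctmx (Q *m ctmx U).
  rewrite ctmxM ctmxK !mulmxA -(mulmxA Q) -(mulmxA Q) -eY /Y !mulmxA mulmxV //.
  by rewrite mul1mx -mulmxA -ctmxM mulmxV // ctmx1 mulmx1.
exists (Q *m ctmx U), x; split=> //.
  by rewrite ctmxM ctmxK mulmxA -(mulmxA Q) UV mulmx1.
by apply: (psdmx_diag uP); rewrite -eX.
Qed.

Lemma det_congr_diag n (P : 'M[C]_n) (d : 'rV[C]_n) :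
  \det (P *m diag_mx d *m ctmx P) = \det (P *m ctmx P) * \prod_k d 0 k.
Proof. by rewrite !det_mulmx det_diag mulrAC. Qed.

Lemma posdefmx_det_gt0 n (A : 'M[C]_n) : posdefmx A -> 0 < \det A.
Proof.
move=> pA; have uA := posdefmx_unit pA; have [Q _ eA] := posdefmx_sqrt pA.
move: uA; rewrite unitmxE unitfE eA det_mulmx det_ctmx.
by rewrite lt0r mul_conjC_ge0 andbT.
Qed.

(** After simultaneous diagonalisation, the quotient of the determinants is the product of the
    [1 + x 0 k] with [x 0 k >= 0]. All factors are at least 1, so one factor above 1 excludes
    equality. *)
Lemma det_posdefmxD n (A B : 'M[C]_n) : posdefmx A -> psdmx B ->
  \det A <= \det (A + B) /\ (\det (A + B) = \det A -> B = 0).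
Proof.
move=> pA pB; have detA_gt0 := posdefmx_det_gt0 pA.
have [P [x [uP eA eB x_ge0]]] := simultaneous_diag pA pB.
pose y : 'rV[C]_n := \row_k (1 + x 0 k).
have eAB : A + B = P *m diag_mx y *m ctmx P.
  have -> : y = const_mx 1 + x by apply/rowP => k; rewrite !mxE.
  by rewrite linearD /= mulmxDr mulmxDl -eB diag_const_mx mulmx1 -eA.
have y_ge1 k : 1 <= y 0 k by rewrite mxE lerDl.
have y_ge0 k : 0 <= y 0 k by rewrite (le_trans ler01).
rewrite eAB det_congr_diag -eA; split.
  rewrite ler_pMr //; elim/big_ind: _ => // u v u1 v1.
  by rewrite -[1]mulr1 ler_pM.
move=> /eqP; rewrite -subr_eq0 -{2}[\det A]mulr1 -mulrBr mulf_eq0 gt_eqF //=.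
rewrite subr_eq0 => /eqP y1; rewrite eB.
suff -> : x = 0 by rewrite linear0 mulmx0 mul0mx.
apply/rowP => k; rewrite [RHS]mxE; apply/eqP; apply: contraT => xk0.
have yk1 : 1 < y 0 k by rewrite mxE ltrDl lt0r xk0 x_ge0.
have : 1 <= \prod_(j | j != k) y 0 j.
  by elim/big_ind: _ => // u v u1 v1; rewrite -[1]mulr1 ler_pM.
move: y1; rewrite (bigD1 k) //= => y1 r1.
have : y 0 k <= 1 by rewrite -y1 ler_peMr.
by move/(lt_le_trans yk1); rewrite ltxx.
Qed.

End Adjoint.

(** * A correlation inequality for products *)

Section ProductInequality.
Variable F : numDomainType.

Lemma unit_itvC (x : F) : 0 <= x <= 1 -> 0 <= 1 - x <= 1.
Proof. by move=> /andP[x0 x1]; rewrite subr_ge0 x1 /= lerBlDr lerDl. Qed.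

Lemma unit_itvM (x y : F) : 0 <= x <= 1 -> 0 <= y <= 1 -> 0 <= x * y <= 1.
Proof. by move=> /andP[x0 x1] /andP[y0 y1]; rewrite mulr_ge0 //= mulr_ile1. Qed.

Lemma unit_itv_prod (I : Type) (r : seq I) (P : pred I) (f : I -> F) :
  (forall i, 0 <= f i <= 1) -> 0 <= \prod_(i <- r | P i) f i <= 1.
Proof.
move=> f01; elim/big_ind: _ => //; first by rewrite ler01 lexx.
exact: unit_itvM.
Qed.

(** The left side equals [(1 - a * b) * (x + y - x * y)]. Its last bracket is the gain of one
    induction step, kept explicit because the strict inequality comes from it. *)
Lemma prod_onem_step (a b x y g : F) :
  x + y - x * y <= g -> 0 <= a <= 1 -> 0 <= b <= 1 ->
  (1 - a) * x + (1 - b) * y - (1 - a) * x * ((1 - b) * y)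
    + (x * (1 - y) * (a * (1 - b)) + y * (1 - x) * (b * (1 - a)))
  <= (1 - a * b) * g.
Proof.
move=> xyg a01 b01; have /andP[ab0 _] := unit_itvC (unit_itvM a01 b01).
apply: le_trans (ler_wpM2l ab0 xyg); rewrite le_eqVlt; apply/orP; left.
by apply/eqP; ring.
Qed.

(** For independent events with probabilities [a i] and [b i], the left side is the probability that
    no first event or no second event occurs, the right side that no [i] has both; the former
    implies the latter. *)
Lemma prod_onem_pair (I : Type) (r : seq I) (P : pred I) (a b : I -> F) :
  (forall i, 0 <= a i <= 1) -> (forall i, 0 <= b i <= 1) ->
  \prod_(i <- r | P i) (1 - a i) + \prod_(i <- r | P i) (1 - b i)
    - \prod_(i <- r | P i) (1 - a i) * \prod_(i <- r | P i) (1 - b i)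
  <= \prod_(i <- r | P i) (1 - a i * b i).
Proof.
move=> a01 b01; elim: r => [|i r IH]; first by rewrite !big_nil mulr1 addrK.
rewrite !big_cons; case: (P i) => //.
apply: le_trans (prod_onem_step IH (a01 i) (b01 i)); rewrite lerDl.
have /andP[x0 x1] : 0 <= \prod_(j <- r | P j) (1 - a j) <= 1.
  by apply: unit_itv_prod => j; apply: unit_itvC.
have /andP[y0 y1] : 0 <= \prod_(j <- r | P j) (1 - b j) <= 1.
  by apply: unit_itv_prod => j; apply: unit_itvC.
have /andP[ai0 ai1] := a01 i; have /andP[bi0 bi1] := b01 i.
by rewrite addr_ge0 // !mulr_ge0 // subr_ge0.
Qed.

(** With [i0] split off, the gain contains [y * (1 - x) * (b i0 * (1 - a i0))], where [y] is
    positive as [b i < 1] away from [i0], and [x < 1] as [a i1] is positive. *)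
Lemma prod_onem_pair_lt (I : finType) (a b : I -> F) (i0 i1 : I) :
  (forall i, 0 < a i <= 1) -> (forall i, 0 < b i <= 1) ->
  i0 != i1 -> a i0 < 1 -> (forall i, i != i0 -> b i < 1) ->
  \prod_i (1 - a i) + \prod_i (1 - b i)
    - \prod_i (1 - a i) * \prod_i (1 - b i) < \prod_i (1 - a i * b i).
Proof.
move=> a01 b01 i01 a1 b1.
have ac i : 0 <= a i <= 1 by have /andP[/ltW-> ->] := a01 i.
have bc i : 0 <= b i <= 1 by have /andP[/ltW-> ->] := b01 i.
have IH := prod_onem_pair (index_enum I) (fun i => i != i0) ac bc.
have splitE (f : I -> F) : \prod_i f i = f i0 * \prod_(i | i != i0) f i.
  by rewrite (bigD1 i0).
rewrite !splitE.
apply: lt_le_trans (prod_onem_step IH (ac i0) (bc i0)); rewrite ltrDl.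
set x := \prod_(i | _) (1 - a i); set y := \prod_(i | _) (1 - b i).
have /andP[x0 x1] : 0 <= x <= 1.
  by apply: unit_itv_prod => j; apply: unit_itvC.
have /andP[_ y1] : 0 <= y <= 1.
  by apply: unit_itv_prod => j; apply: unit_itvC.
have y_gt0 : 0 < y by apply: prodr_gt0 => i /b1; rewrite subr_gt0.
have x_lt1 : x < 1.
  rewrite /x (bigD1 i1) 1?eq_sym //=; apply: (@le_lt_trans _ _ (1 - a i1)).
    rewrite ler_piMr //; first by have /andP[] := unit_itvC (ac i1).
    by have /andP[] := @unit_itv_prod _ (index_enum I)
      (fun i => (i != i0) && (i != i1)) _ (fun i => unit_itvC (ac i)).
  by rewrite ltrBlDr ltrDl; have /andP[] := a01 i1.
have /andP[ai0 ai1] := ac i0; have /andP[b0 bi1] := b01 i0.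
rewrite ltr_wpDl // ?mulr_gt0 ?subr_gt0 //.
by rewrite !mulr_ge0 ?subr_ge0 // ltW.
Qed.

(* With independent events [E p t] of probability [u p t], the two sides are
   P(some p has E p t for all t) and P(every t has E p t for some p). *)
Lemma prod_onem_le (I T : Type) (s : seq I) (r : seq T) (P : pred T)
    (u : I -> T -> F) : (forall p t, 0 <= u p t <= 1) ->
  1 - \prod_(p <- s) (1 - \prod_(t <- r | P t) u p t)
  <= \prod_(t <- r | P t) (1 - \prod_(p <- s) (1 - u p t)).
Proof.
move=> u01; elim: r => [|t r IH].
  under eq_bigr do rewrite big_nil subrr.
  rewrite big_nil lerBlDr lerDl.
  by have /andP[] := @unit_itv_prod _ s predT (fun=> 0)
    (fun=> introT andP (conj (lexx _) ler01)).
rewrite big_cons; under eq_bigr do rewrite big_cons.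
case: (P t) => //.
have := prod_onem_pair s predT (u01^~ t)
  (fun p => unit_itv_prod r P (u01 p)).
rewrite /=; set x := \prod_(p <- s) _; set y := \prod_(p <- s) _; set z := \prod_(p <- s) _.
move=> xyz; apply: (@le_trans _ _ ((1 - x) * (1 - y))).
  rewrite -subr_ge0.
  have -> : (1 - x) * (1 - y) - (1 - z) = z - (x + y - x * y) by ring.
  by rewrite subr_ge0.
apply: ler_wpM2l => //; suff /unit_itvC/andP[] : 0 <= x <= 1 by [].
by apply: unit_itv_prod => p; apply: unit_itvC.
Qed.

(** Only the step that splits off [t0] has to be strict. There the second family is the product over
    [t != t0], which the factor at [t1] pushes below 1 for every [p != p0]. *)
Lemma prod_onem_lt (I T : finType) (u : I -> T -> F) (p0 p1 : I) (t0 t1 : T) :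
  (forall p t, 0 < u p t <= 1) -> p0 != p1 -> t0 != t1 ->
  u p0 t0 < 1 -> (forall p, p != p0 -> u p t1 < 1) ->
  1 - \prod_p (1 - \prod_t u p t) < \prod_t (1 - \prod_p (1 - u p t)).
Proof.
move=> u01 p01 t01 u00 up1.
have uc p t : 0 <= u p t <= 1 by have /andP[/ltW-> ->] := u01 p t.
rewrite (bigD1 t0) //=; under eq_bigr do rewrite (bigD1 t0) //=.
have := @prod_onem_pair_lt _ (u^~ t0) (fun p => \prod_(t | t != t0) u p t) p0 p1
  (u01^~ t0) _ p01 u00 _.
have IH := prod_onem_le (index_enum I) (index_enum T) (fun t => t != t0) uc.
rewrite /= in IH *; set x := \prod_p _; set y := \prod_p _ in IH *; set z := \prod_p _ => xyz.
apply: (@lt_le_trans _ _ ((1 - x) * (1 - y))).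
  rewrite -subr_gt0.
  have -> : (1 - x) * (1 - y) - (1 - z) = z - (x + y - x * y) by ring.
  rewrite subr_gt0; apply: xyz => p.
    rewrite prodr_gt0 => [|t _]; last by have /andP[] := u01 p t.
    by have /andP[] := unit_itv_prod (index_enum T) (fun t => t != t0) (uc p).
  move=> /up1 upt1; rewrite (bigD1 t1) 1?eq_sym //=.
  apply: le_lt_trans upt1; rewrite ler_piMr //; first by have /andP[] := uc p t1.
  by have /andP[] := unit_itv_prod (index_enum T)
    (fun t => (t != t0) && (t != t1)) (uc p).
apply: ler_wpM2l => //; suff /unit_itvC/andP[] : 0 <= x <= 1 by [].
by apply: unit_itv_prod => p; apply: unit_itvC.
Qed.

End ProductInequality.

(** * Iterated Kronecker products *)

Section TensorExtra.

Lemma mxtens_unindex_bij m n : bijective (@mxtens_unindex m n).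
Proof. exact: Bijective (@mxtens_unindexK m n) (@mxtens_indexK m n). Qed.

Lemma prod_mxtens (C : comNzRingType) m n (f : 'I_m * 'I_n -> C) :
  \prod_(t < m * n) f (mxtens_unindex t) = \prod_(a < m) \prod_(b < n) f (a, b).
Proof.
rewrite pair_big (reindex (@mxtens_unindex m n)) /=; last first.
  exact/onW_bij/mxtens_unindex_bij.
by apply: eq_bigr => t _; congr f.
Qed.

Lemma tensmx11 (C : nzRingType) m n :
  (1%:M : 'M[C]_m) *t (1%:M : 'M[C]_n) = 1%:M.
Proof.
apply/matrixP => s t; case: (mxtens_indexP s) => a b; case: (mxtens_indexP t) => c d.
rewrite tensmxE !mxE (can_eq (@mxtens_indexK m n)) xpair_eqE.
by case: (a == c); case: (b == d); rewrite ?mulr0 ?mulr1.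
Qed.

Lemma tensmx_eq0 (C : idomainType) m n p q (A : 'M[C]_(m, n)) (B : 'M[C]_(p, q)) :
  A *t B = 0 -> A = 0 \/ B = 0.
Proof.
move=> AB0; have [->|/eqP/matrixP A0] := eqVneq A 0; [by left | right].
apply/matrixP => c d; rewrite mxE; apply/eqP; apply: contraT => Bcd.
case: A0 => a b; rewrite [RHS]mxE; apply/eqP.
have /matrixP/(_ (mxtens_index (a, c)) (mxtens_index (b, d))) := AB0.
by rewrite tensmxE mxE => /eqP; rewrite mulf_eq0 (negPf Bcd) orbF.
Qed.

Lemma tens_diag_mx (C : nzRingType) m n (a : 'rV[C]_m) (b : 'rV[C]_n) :
  diag_mx a *t diag_mx b =
  diag_mx (\row_t (a 0 (mxtens_unindex t).1 * b 0 (mxtens_unindex t).2)).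
Proof.
apply/matrixP => s t; case: (mxtens_indexP s) => i j; case: (mxtens_indexP t) => k l.
rewrite tensmxE !mxE mxtens_indexK (can_eq (@mxtens_indexK m n)) xpair_eqE /=.
by case: eqP; case: eqP; rewrite ?mulr1n ?mulr0n ?mulr0 ?mul0r.
Qed.

Lemma kdimE (n : nat -> nat -> nat) j k : kdim n j k = (\prod_(q < k) n j q)%N.
Proof. by elim: k => [|k IH]; rewrite ?big_ord0 // big_ord_recr /= IH. Qed.

End TensorExtra.

Section IteratedKronecker.
Variables (C : comNzRingType).

(** Separate size families for rows and columns admit rectangular factors, such as frames in ambient
    spaces whose dimension varies with [p]. *)
Fixpoint ikron (n n' : nat -> nat -> nat) (j j' : nat)
    (M : forall p, 'M[C]_(n j p, n' j' p)) (k : nat) :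
    'M[C]_(kdim n j k, kdim n' j' k) :=
  match k return 'M[C]_(kdim n j k, kdim n' j' k) with
  | 0 => (1%:M : 'M[C]_1)
  | k'.+1 => ikron M k' *t M k'
  end.

Lemma kron_blk_ikron n (Ab : forall p j l, 'M[C]_(n j p, n l p)) j l k :
  kron_blk Ab j l k = ikron (fun p => Ab p j l) k.
Proof. by elim: k => //= k ->. Qed.

Lemma eq_ikron n n' j j' (M M' : forall p, 'M[C]_(n j p, n' j' p)) k :
  (forall p, (p < k)%N -> M p = M' p) -> ikron M k = ikron M' k.
Proof.
elim: k => //= k IH eM; rewrite IH ?eM // => p ltpk.
by rewrite eM // ltnW.
Qed.

Lemma ikronM n n' n'' j j' j'' (M : forall p, 'M[C]_(n j p, n' j' p))
    (M' : forall p, 'M[C]_(n' j' p, n'' j'' p)) k :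
  ikron M k *m ikron M' k = ikron (fun p => M p *m M' p) k.
Proof. by elim: k => [|k IH] /=; rewrite ?mulmx1 // tensmx_mul IH. Qed.

Lemma ikron1 n j k : ikron (fun p => 1%:M : 'M[C]_(n j p)) k = 1%:M.
Proof. by elim: k => //= k ->; rewrite tensmx11. Qed.

Lemma ikron0 n n' j j' (M : forall p, 'M[C]_(n j p, n' j' p)) k p :
  (p < k)%N -> M p = 0 -> ikron M k = 0.
Proof.
elim: k => //= k IH; rewrite ltnS leq_eqVlt => /predU1P[<- ->|ltpk Mp].
  by rewrite tensmx0.
by rewrite IH // tens0mx.
Qed.

(* The value of [x p] at the [p]-th mixed-radix digit of the multi-index [t]
   (junk value 1 when [k <= p]). *)
Fixpoint digval n j (x : forall p, 'I_(n j p) -> C) (k p : nat) :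
    'I_(kdim n j k) -> C :=
  match k return 'I_(kdim n j k) -> C with
  | 0 => fun _ => 1
  | k'.+1 => fun t => if p == k' then x k' (mxtens_unindex t).2
                      else digval x p (mxtens_unindex t).1
  end.

Lemma ikron_diag n j (d : forall p, 'rV[C]_(n j p)) k :
  ikron (fun p => diag_mx (d p)) k =
  diag_mx (\row_t \prod_(p < k) digval (fun p a => d p 0 a) p t).
Proof.
elim: k => [|k IH] /=.
  apply/matrixP => s t; rewrite !mxE !ord1 eqxx.
  by rewrite big_ord0.
rewrite IH tens_diag_mx; congr diag_mx; apply/rowP => t.
rewrite !mxE big_ord_recr /= eqxx; congr (_ * _); apply: eq_bigr => p _.
by rewrite ltn_eqF.
Qed.

(** * Counting and choosing mixed-radix digits *)

Section Digits.
Variables (n : nat -> nat -> nat) (j : nat) (x : forall p, 'I_(n j p) -> C).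
Arguments x : clear implicits.

Lemma digvalS k p (t : 'I_(kdim n j k)) a :
  digval x (k := k.+1) p (mxtens_index (t, a)) =
  if p == k then x k a else digval x p t.
Proof.
rewrite -[LHS]/(if p == k then x k (mxtens_unindex _).2
                else digval x p (mxtens_unindex _).1).
by rewrite mxtens_indexK.
Qed.

(** Each value of the [p]-th digit is taken by the same number of multi-indices, the product of the
    other sizes. This is the origin of the exponents sigma. *)
Lemma digval_prod (f : C -> C) k p : (p < k)%N ->
  (forall q, (q < k)%N -> (0 < n j q)%N) ->
  \prod_t f (digval x (k := k) p t) =
  (\prod_a f (x p a)) ^+ ((\prod_(q < k) n j q) %/ n j p).
Proof.
elim: k => // k IH ltpk n_gt0; rewrite big_ord_recr /=.
rewrite (prod_mxtens (fun ab => f (if p == k then x k ab.2 else digval x p ab.1))).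
have [pk|npk] := eqVneq p k.
  rewrite pk mulnK ?n_gt0 // -kdimE /=.
  by rewrite prodr_const card_ord.
have {npk}ltpk : (p < k)%N by rewrite ltn_neqAle npk -ltnS.
have pdvd : (n j p %| \prod_(q < k) n j q)%N.
  by rewrite (bigD1 (Ordinal ltpk)) //= dvdn_mulr.
(* The natural division is exact, so the new size moves out of it and becomes an outer power. *)
rewrite -divn_mulAC // exprM -IH // => [|q ltqk]; last by rewrite n_gt0 // ltnW.
by rewrite /= -prodrXl; apply: eq_bigr => a _; rewrite prodr_const card_ord.
Qed.

Lemma digvalP (Q : C -> Prop) k p t : (p < k)%N ->
  (forall a, Q (x p a)) -> Q (digval x (k := k) p t).
Proof.
elim: k t => //= k IH t ltpk Qx; case: eqVneq => [pk|npk].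
  by move: Qx; rewrite pk.
by apply: IH => //; rewrite ltn_neqAle npk -ltnS.
Qed.

Lemma digval_surj (Q : nat -> C -> Prop) k :
  (forall p, (p < k)%N -> exists a, Q p (x p a)) ->
  exists t, forall p, (p < k)%N -> Q p (digval x (k := k) p t).
Proof.
elim: k => [|k IH] exQ; first by exists ord0.
have [|t Qt] := IH; first by move=> p ltpk; apply/exQ/ltnW.
have [a Qa] := exQ k (ltnSn k).
exists (mxtens_index (t, a)) => p ltpk; rewrite digvalS.
case: eqVneq => [-> //|npk]; apply: Qt.
by rewrite ltn_neqAle npk -ltnS.
Qed.

Lemma digval_change k p0 (t0 : 'I_(kdim n j k)) : (p0 < k)%N -> (1 < n j p0)%N ->
  exists2 t1, t0 != t1 &
    forall p, (p < k)%N -> p != p0 -> digval x p t1 = digval x p t0.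
Proof.
elim: k t0 => // k IH t0 ltpk n_gt1.
case: (mxtens_indexP t0) => t a; have [pk|npk] := eqVneq p0 k.
  rewrite pk in n_gt1; have [b ab] : exists b : 'I_(n j k), a != b.
    have [->|a0] := eqVneq a (Ordinal (ltnW n_gt1)).
      by exists (Ordinal n_gt1).
    by exists (Ordinal (ltnW n_gt1)).
  exists (mxtens_index (t, b)).
    by rewrite (can_eq (@mxtens_indexK _ _)) xpair_eqE eqxx.
  by move=> p _; rewrite pk => /negPf np0; rewrite !digvalS np0.
have [|//|t1 nt t1E] := IH t; first by rewrite ltn_neqAle npk -ltnS.
exists (mxtens_index (t1, a)).
  by rewrite (can_eq (@mxtens_indexK _ _)) xpair_eqE (negPf nt).
move=> p ltp np0; rewrite !digvalS; case: eqVneq => // nk.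
by apply: t1E => //; rewrite ltn_neqAle nk -ltnS.
Qed.

End Digits.
End IteratedKronecker.

Lemma ikron_eq0 (C : idomainType) n n' j j'
    (M : forall p, 'M[C]_(n j p, n' j' p)) k :
  ikron M k = 0 -> exists2 p, (p < k)%N & M p = 0.
Proof.
elim: k => /= [/matrixP/(_ 0 0)/eqP|k IH]; first by rewrite !mxE oner_eq0.
case/tensmx_eq0 => [/IH[p ltpk Mp]|Mk]; last by exists k.
by exists p => //; apply: ltnW.
Qed.

(** * Adjoints, units and determinants of iterated Kronecker products *)

Section KroneckerPositive.
Variable C : numClosedFieldType.

Lemma ctmx_ikron n n' j j' (M : forall p, 'M[C]_(n j p, n' j' p)) k :
  ctmx (ikron M k) = ikron (fun p => ctmx (M p)) k.
Proof.
elim: k => [|k IH] /=; first exact: ctmx1.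
by rewrite -IH /ctmx trmx_tens map_mxT.
Qed.

Lemma ikron_unit n j (P : forall p, 'M[C]_(n j p)) k :
  (forall p, (p < k)%N -> P p \in unitmx) -> ikron P k \in unitmx.
Proof.
move=> uP; suff /mulmx1_unit[] : ikron P k *m ikron (fun p => invmx (P p)) k = 1%:M.
  by [].
rewrite ikronM -(ikron1 C n j k); apply: eq_ikron => p ltpk.
by rewrite mulmxV ?uP.
Qed.

(** Unitary diagonalisation of the factors turns the determinant into a product, over multi-indices,
    of products of eigenvalues. Exchanging the two products and counting digits gives the powers. *)
Lemma det_ikron_posdef n j (A : forall p, 'M[C]_(n j p)) k :
  (forall p, (p < k)%N -> (0 < n j p)%N) ->
  (forall p, (p < k)%N -> posdefmx (A p)) ->
  \det (ikron A k) = \prod_(p < k) \det (A p) ^+ ((\prod_(q < k) n j q) %/ n j p).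
Proof.
move=> n_gt0 pA.
(* The implication makes the statement hold for every natural [p], with junk beyond [k], so that
   choice yields total families. *)
have ex p : exists Ud : 'M[C]_(n j p) * 'rV[C]_(n j p), (p < k)%N ->
    Ud.1 *m ctmx Ud.1 = 1%:M /\ A p = ctmx Ud.1 *m diag_mx Ud.2 *m Ud.1.
  have [ltpk|] := ltnP p k; last by exists (0, 0).
  by have [U [d Ud]] := hermitian_spectral (pA p ltpk).1; exists (U, d).
pose Ud p := projT1 (cid (ex p)).
pose U p := (Ud p).1; pose d p := (Ud p).2.
have UdP p ltpk : U p *m ctmx (U p) = 1%:M /\ A p = ctmx (U p) *m diag_mx (d p) *m U p
  := projT2 (cid (ex p)) ltpk.
have UU : ikron U k *m ctmx (ikron U k) = 1%:M.
  rewrite ctmx_ikron ikronM -(ikron1 C n j k); apply: eq_ikron => p /UdP[//].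
have detUU : \det (ctmx (ikron U k)) * \det (ikron U k) = 1.
  by rewrite mulrC -det_mulmx UU det1.
have -> : ikron A k = ctmx (ikron U k) *m ikron (fun p => diag_mx (d p)) k *m ikron U k.
  by rewrite ctmx_ikron !ikronM; apply: eq_ikron => p /UdP[].
rewrite !det_mulmx mulrAC detUU mul1r ikron_diag det_diag.
under eq_bigr do rewrite mxE.
rewrite exchange_big /=; apply: eq_bigr => p _.
rewrite (digval_prod (fun p a => d p 0 a) id) //; congr (_ ^+ _).
have [UU1 ->] := UdP p (ltn_ord p).
by rewrite !det_mulmx mulrAC -det_mulmx (mulmx1C UU1) det1 mul1r det_diag.
Qed.

End KroneckerPositive.

Lemma prod_ord_single (C : comNzRingType) k (f : 'I_k -> C) t0 :
  k = 1%N -> \prod_t f t = f t0.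
Proof.
move=> k1; apply: big_pred1 => t; symmetry; apply/eqP/val_inj.
by move: t t0; rewrite k1 => t t0; rewrite !ord1.
Qed.

(** * The determinant of a difference of two Kronecker products *)

Section KroneckerDifference.
Variables (C : numClosedFieldType) (n : nat -> nat -> nat) (j k : nat).
Variables (A X : forall p, 'M[C]_(n j p)).
Hypothesis n_gt0 : forall p, (p < k)%N -> (0 < n j p)%N.
Hypothesis posA : forall p, (p < k)%N -> posdefmx (A p).
Hypothesis psdX : forall p, (p < k)%N -> psdmx (X p).
Hypothesis posAX : forall p, (p < k)%N -> posdefmx (A p - X p).
Hypothesis k_gt0 : (0 < k)%N.

Let s p := ((\prod_(q < k) n j q) %/ n j p)%N.
Let bound := \prod_(p < k) \det (A p) ^+ s p
  - \prod_(p < k) (\det (A p) ^+ s p - \det (A p - X p) ^+ s p).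
Let D := ikron A k - ikron X k.

Lemma ikron_sub_spec :
  exists (P : forall p, 'M[C]_(n j p)) (x : forall p, 'rV[C]_(n j p)),
  [/\ forall p, (p < k)%N -> P p \in unitmx /\ A p = P p *m ctmx (P p),
      forall p, (p < k)%N -> X p = P p *m diag_mx (x p) *m ctmx (P p) &
      forall p a, (p < k)%N -> 0 <= x p 0 a < 1].
Proof.
have ex p : exists Px : 'M[C]_(n j p) * 'rV[C]_(n j p), (p < k)%N ->
    [/\ Px.1 \in unitmx, A p = Px.1 *m ctmx Px.1,
        X p = Px.1 *m diag_mx Px.2 *m ctmx Px.1 & forall a, 0 <= Px.2 0 a].
  have [ltpk|] := ltnP p k; last by exists (0, 0).
  by have [P [x Px]] := simultaneous_diag (posA ltpk) (psdX ltpk); exists (P, x).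
pose P p := (projT1 (cid (ex p))).1; pose x p := (projT1 (cid (ex p))).2.
have PxP p ltpk : [/\ P p \in unitmx, A p = P p *m ctmx (P p),
        X p = P p *m diag_mx (x p) *m ctmx (P p) & forall a, 0 <= x p 0 a]
  := projT2 (cid (ex p)) ltpk.
exists P, x; split=> [p /PxP[] //|p /PxP[] //|p a ltpk].
have [uP eA eX x_ge0] := PxP p ltpk; rewrite x_ge0 /=.
have : posdefmx (P p *m diag_mx (const_mx 1 - x p) *m ctmx (P p)).
  by rewrite linearB /= mulmxBr mulmxBl -eX diag_const_mx mulmx1 -eA; apply: posAX.
by move/(posdefmx_diag _ uP)/(_ a); rewrite !mxE subr_gt0.
Qed.

(** Congruence by [ikron P k] makes [D] diagonal, with entries 1 minus a product of digits of the
    [x p]. The bound and the determinant become a common positive factor times the two sides of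
    [prod_onem_le]. *)
Lemma ikron_sub_digits :
  exists x : forall p, 'rV[C]_(n j p),
  let u (p : 'I_k) t := 1 - digval (k := k) (fun p a => x p 0 a) p t in
  let alpha := \prod_(p < k) \det (A p) ^+ s p in
  [/\ forall p a, (p < k)%N -> 0 <= x p 0 a < 1,
      forall p, (p < k)%N -> x p = 0 -> X p = 0,
      bound = alpha * (1 - \prod_p (1 - \prod_t u p t)),
      \det D = alpha * \prod_t (1 - \prod_p (1 - u p t)) & 0 < alpha /\ posdefmx D].
Proof.
have [P [x [PA PX x01]]] := ikron_sub_spec; exists x => u alpha.
have uE p t : 1 - u p t = digval (fun p a => x p 0 a) p t by rewrite /u opprB addrC subrK.
have dA p : (p < k)%N -> \det (A p - X p) = \det (A p) * \prod_a (1 - x p 0 a).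
  move=> ltpk; have [uP eA] := PA p ltpk.
  have -> : A p - X p = P p *m diag_mx (const_mx 1 - x p) *m ctmx (P p).
    by rewrite linearB /= mulmxBr mulmxBl -(PX p ltpk) diag_const_mx mulmx1 -eA.
  by rewrite det_congr_diag -eA; congr (_ * _); apply: eq_bigr => a _; rewrite !mxE.
pose e : 'rV[C]_(kdim n j k) := \row_t (1 - \prod_p (1 - u p t)).
have uP : ikron P k \in unitmx by apply: ikron_unit => p /PA[].
have eD : D = ikron P k *m diag_mx e *m ctmx (ikron P k).
  have -> : e = const_mx 1 - \row_t \prod_(p < k) digval (fun p a => x p 0 a) p t.
    apply/rowP => t; rewrite !mxE; congr (_ - _); apply: eq_bigr => p _.
    by rewrite uE.
  rewrite linearB /= mulmxBr mulmxBl diag_const_mx mulmx1 -ikron_diag.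
  rewrite ctmx_ikron !ikronM /D; congr (_ - _); apply: eq_ikron => p ltpk.
    by case: (PA p ltpk).
  exact: PX.
have dPE : \det (ikron P k *m ctmx (ikron P k)) = alpha.
  rewrite /alpha -(det_ikron_posdef n_gt0 posA) ctmx_ikron ikronM; congr (\det _).
  by apply: eq_ikron => p ltpk; case: (PA p ltpk).
split=> //.
- by move=> p ltpk x0; rewrite (PX p ltpk) x0 linear0 mulmx0 mul0mx.
- rewrite mulrBr mulr1 /bound -/alpha -big_split /=; congr (_ - _).
  apply: eq_bigr => p _; rewrite mulrBr mulr1; congr (_ - _).
  rewrite dA // exprMn; congr (_ * _).
  by rewrite (digval_prod (fun p a => x p 0 a) (fun y => 1 - y)).
- rewrite eD det_congr_diag dPE; congr (_ * _).
  by apply: eq_bigr => t _; rewrite mxE.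
split.
  by apply: prodr_gt0 => p _; apply/exprn_gt0/posdefmx_det_gt0/posA.
rewrite eD; apply/posdefmx_diag => // t; rewrite mxE subr_gt0.
(* At least one factor is needed: an empty product would be 1 and the diagonal entry 0. *)
have p0 : 'I_k := Ordinal k_gt0.
have u01 p : 0 <= 1 - u p t < 1.
  by rewrite uE; apply: (@digvalP _ _ _ _ (fun y => 0 <= y < 1)) => // a; apply: x01.
rewrite (bigD1 p0) //=; have /andP[a0 a1] := u01 p0.
apply: le_lt_trans a1; rewrite ler_piMr //.
suff /andP[] : 0 <= \prod_(p < k | p != p0) (1 - u p t) <= 1 by [].
by apply: unit_itv_prod => p; have /andP[-> /ltW] := u01 p.
Qed.

Lemma posdefmx_ikron_sub : posdefmx D.
Proof. by have [x [_ _ _ _ []]] := ikron_sub_digits. Qed.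

Lemma det_ikron_sub_ge : bound <= \det D.
Proof.
have [x /= [x01 _ -> -> [a_gt0 _]]] := ikron_sub_digits.
rewrite ler_pM2l //; apply: prod_onem_le => p t; apply: unit_itvC.
have : 0 <= digval (k := k) (fun p a => x p 0 a) p t < 1.
  by apply: (@digvalP _ _ _ _ (fun y => 0 <= y < 1)) => // a; apply: x01.
by move=> /andP[-> /ltW].
Qed.

(** There is a single multi-index, so both scalar sides reduce to [1 - \prod_p (1 - u p t0)]. *)
Lemma det_ikron_sub_dim1 : (forall p, (p < k)%N -> n j p = 1%N) -> \det D = bound.
Proof.
move=> n1; have [x /= [_ _ -> -> _]] := ikron_sub_digits; congr (_ * _).
have kd1 : kdim n j k = 1%N by rewrite kdimE big1 // => p _; rewrite n1.
have t0 : 'I_(kdim n j k) by rewrite kd1; exact: ord0.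
rewrite (prod_ord_single _ t0) //; congr (1 - _); apply: eq_bigr => p _.
by rewrite (prod_ord_single _ t0).
Qed.

Lemma det_ikron_sub_single : k = 1%N -> \det D = bound.
Proof.
move=> k1; have [x /= [_ _ -> -> _]] := ikron_sub_digits; congr (_ * _).
rewrite (prod_ord_single _ (Ordinal k_gt0)) // subKr; apply: eq_bigr => t _.
by rewrite (prod_ord_single _ (Ordinal k_gt0)) // subKr.
Qed.

(** If [n j p0 > 1], take [t0] with all digit values positive and [t1] differing from it only in the
    digit [p0]. These two indices make the scalar inequality strict. *)
Lemma det_ikron_sub_eq : (1 < k)%N -> (forall p, (p < k)%N -> X p != 0) ->
  \det D = bound -> forall p, (p < k)%N -> n j p = 1%N.
Proof.
move=> k_gt1 X0; have [x /= [x01 xX -> ->]] := ikron_sub_digits.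
pose u (p : 'I_k) t := 1 - digval (k := k) (fun p a => x p 0 a) p t.
move=> -[a_gt0 _] /(mulfI (lt0r_neq0 a_gt0)) eqD p0 ltp0.
apply/eqP; apply: contraT => n_neq1.
have n_gt1 : (1 < n j p0)%N by rewrite ltn_neqAle eq_sym n_neq1 n_gt0.
have [t0 t0P] : exists t0, forall p, (p < k)%N ->
    0 < digval (k := k) (fun p a => x p 0 a) p t0.
  apply: (@digval_surj _ _ _ _ (fun _ y => 0 < y)) => p ltpk.
  have /eqP/rowP x0 : x p != 0 by apply: contraNneq (X0 p ltpk) => /(xX p ltpk) ->.
  apply: contrapT => /forallNP xle0; apply: x0 => a; rewrite mxE.
  apply/eqP; apply: contraT => xa; case: (xle0 a).
  by have /andP[] := x01 p a ltpk; rewrite lt0r xa.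
have [t1 t01 t1P] := digval_change (fun p a => x p 0 a) t0 ltp0 n_gt1.
have [p1 p01] : exists p1, Ordinal ltp0 != p1.
  have [->|np] := eqVneq (Ordinal ltp0) (Ordinal k_gt0).
    by exists (Ordinal k_gt1).
  by exists (Ordinal k_gt0).
have := @prod_onem_lt _ _ _ u (Ordinal ltp0) p1 t0 t1 _ p01 t01.
rewrite eqD ltxx; apply.
- move=> p t; rewrite /u subr_gt0.
  have /andP[y0 ->] : 0 <= digval (k := k) (fun p a => x p 0 a) p t < 1.
    by apply: (@digvalP _ _ _ _ (fun y => 0 <= y < 1)) => // a; apply: x01.
  by rewrite lerBlDr lerDl.
- by rewrite ltrBlDr ltrDl t0P.
- by move=> p np; rewrite ltrBlDr ltrDl t1P ?t0P.
Qed.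

End KroneckerDifference.

(** * Gram factorisations and orthogonal projection *)

Section GramFrame.
Variable C : numClosedFieldType.

(** A biorthogonal family certifies that the rows of all [G j], [j < s], are jointly linearly
    independent. As explicit data it passes to tensor products and extracts coefficients. *)
Definition dual_frame (N : nat -> nat) M s (G : forall j, 'M[C]_(N j, M))
    (D : forall j, 'M[C]_(M, N j)) :=
  (forall j, (j < s)%N -> G j *m D j = 1%:M) /\
  (forall j l, (j < s)%N -> (l < s)%N -> j != l -> G j *m D l = 0).

(** Block extraction extended by 0 to all natural indices, since frames are families over [nat]. *)
Definition nat_submxcol (N : nat -> nat) s m (Q : 'M[C]_(\sum_(j < s) N j, m)) j :
    'M[C]_(N j, m) :=
  match @idP (j < s)%N with
  | ReflectT h => @submxcol C s (fun j : 'I_s => N j) m Q (Ordinal h)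
  | ReflectF _ => 0
  end.

Lemma nat_submxcolE (N : nat -> nat) s m (Q : 'M[C]_(\sum_(j < s) N j, m)) j
    (h : (j < s)%N) :
  nat_submxcol Q j = @submxcol C s (fun j : 'I_s => N j) m Q (Ordinal h).
Proof.
rewrite /nat_submxcol; case: {-}_ / idP => // h'.
by congr (submxcol Q (Ordinal _)); apply: bool_irrelevance.
Qed.

Lemma submxblock_1 s (N : 'I_s -> nat) j : submxblock (1%:M : 'M[C]_(\sum_j N j)) j j = 1%:M.
Proof.
apply/matrixP => a b; rewrite !mxE -[_ == _ in LHS]val_eqE.
by rewrite [_ == _ in LHS]tagnat.eq_Rank eqxx.
Qed.

Lemma submxblock_1_neq s (N : 'I_s -> nat) j l :
  j != l -> submxblock (1%:M : 'M[C]_(\sum_j N j)) j l = 0.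
Proof.
move=> /negPf jl; apply/matrixP => a b; rewrite !mxE -[_ == _ in LHS]val_eqE.
by rewrite [_ == _ in LHS]tagnat.eq_Rank jl.
Qed.

(** With [Q] a square root of the whole matrix, the frame consists of the block rows of [Q] and its
    dual of the block columns of [invmx Q]. *)
Lemma posdefmx_dual_frame N (B : forall j l, 'M[C]_(N j, N l)) s :
  posdefmx (leadmx B s) ->
  exists M (G : forall j, 'M[C]_(N j, M)) (D : forall j, 'M[C]_(M, N j)),
    dual_frame s G D /\
    forall j l, (j < s)%N -> (l < s)%N -> B j l = G j *m ctmx (G l).
Proof.
case/posdefmx_sqrt => Q uQ eB.
pose D j := (nat_submxcol (invmx Q)^T j)^T.
have DE j (h : (j < s)%N) : D j = submxrow (invmx Q) (Ordinal h).
  by rewrite /D nat_submxcolE; apply/matrixP => a b; rewrite !mxE.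
exists _, (nat_submxcol Q), D; split; first split.
- move=> j h; rewrite nat_submxcolE DE submxcol_mul mul_submxrow mulmxV //.
  by rewrite -submxblockEh submxblock_1.
- move=> j l hj hl jl; rewrite nat_submxcolE DE submxcol_mul mul_submxrow mulmxV //.
  by rewrite -submxblockEh submxblock_1_neq.
move=> j l hj hl; rewrite !nat_submxcolE.
have := congr1 (fun X => submxblock X (Ordinal hj) (Ordinal hl)) eB.
rewrite /leadmx mxblockK => ->.
rewrite submxblockEv -submxcol_mul -mul_submxrow; congr (_ *m _).
by apply/matrixP => a b; rewrite !mxE.
Qed.

Lemma gram_proj m M (G H : 'M[C]_(m, M)) : (G - H) *m ctmx H = 0 ->
  (G - H) *m ctmx (G - H) = G *m ctmx G - H *m ctmx H.
Proof.
move=> GH; have GHH : G *m ctmx H = H *m ctmx H.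
  by apply/eqP; rewrite -subr_eq0 -mulmxBl GH.
have HG : H *m ctmx G = H *m ctmx H.
  by rewrite -[LHS]ctmxK ctmxM ctmxK GHH ctmx_gram.
by rewrite ctmxB mulmxBr GH subr0 mulmxBl HG.
Qed.

(** * Orthogonal projection of block [i] onto the rows of the earlier blocks *)

Section Projection.
Variables (N : nat -> nat) (M s i : nat).
Variables (G : forall j, 'M[C]_(N j, M)) (D : forall j, 'M[C]_(M, N j)).
Hypothesis frameGD : dual_frame s G D.
Hypothesis lt_is : (i < s)%N.
Arguments G : clear implicits.
Arguments D : clear implicits.

Let lt_s l : (l < i)%N -> (l < s)%N.
Proof. by move=> /ltn_trans; apply. Qed.

Definition lincomb (w : forall l, 'M[C]_(N i, N l)) := \sum_(l < i) w l *m G l.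

Lemma lincomb_orth (w : forall l, 'M[C]_(N i, N l)) m (Z : 'M[C]_(m, M)) :
  (forall l, (l < i)%N -> Z *m ctmx (G l) = 0) -> Z *m ctmx (lincomb w) = 0.
Proof.
move=> Z0; rewrite ctmx_sum mulmx_sumr big1 // => l _.
by rewrite ctmxM mulmxA Z0 // mul0mx.
Qed.

Lemma lincomb_dual w l : (l < i)%N -> lincomb w *m D l = w l.
Proof.
move=> ltl; rewrite mulmx_suml (bigD1 (Ordinal ltl)) //= big1 => [|l' nl].
  by rewrite addr0 -mulmxA frameGD.1 ?mulmx1 ?lt_s.
by rewrite -mulmxA frameGD.2 ?mulmx0 ?lt_s.
Qed.

Lemma posdefmx_leadmx (B : forall j l, 'M[C]_(N j, N l)) :
  (forall j l, (j < i)%N -> (l < i)%N -> B j l = G j *m ctmx (G l)) ->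
  posdefmx (leadmx B i).
Proof.
move=> BE; pose Gc := \mxcol_(j < i) G j; pose Dr := \mxrow_(l < i) D l.
have GD : Gc *m Dr = 1%:M.
  rewrite mul_mxcol_mxrow; apply/mxblockP => j l; rewrite mxblockK.
  have [<-|jl] := eqVneq j l; first by rewrite submxblock_1 frameGD.1 ?lt_s.
  by rewrite submxblock_1_neq // frameGD.2 ?lt_s.
suff -> : leadmx B i = Gc *m ctmx Gc by apply: posdefmx_gram GD.
have -> : ctmx Gc = \mxrow_(l < i) ctmx (G l).
  by apply/matrixP => a b; rewrite !mxE.
by rewrite mul_mxcol_mxrow; apply: eq_mxblock => j l; rewrite BE.
Qed.

(** The coefficients solve the normal equations, whose matrix is the invertible Gram matrix of the
    earlier blocks. *)
Lemma exists_proj : exists w : forall l, 'M[C]_(N i, N l),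
  forall l, (l < i)%N -> (G i - lincomb w) *m ctmx (G l) = 0.
Proof.
pose B j l := G j *m ctmx (G l).
have /posdefmx_unit uB : posdefmx (leadmx B i) by apply: posdefmx_leadmx.
pose W := (\mxrow_(l < i) B i l) *m invmx (leadmx B i).
pose w l := (nat_submxcol W^T l)^T.
have wE (Z : 'M[C]_(N i, _)) (l : 'I_i) : (nat_submxcol Z^T l)^T = submxrow Z l.
  by case: l => l h /=; rewrite (nat_submxcolE _ h); apply/matrixP => a b; rewrite !mxE.
have eW : \mxrow_(l < i) w l = W.
  by rewrite -[RHS]submxrowK; apply: eq_mxrow => l; apply: wE.
have : W *m leadmx B i = \mxrow_(l < i) B i l by rewrite mulmxKV.
rewrite -eW /leadmx mul_mxrow_mxblock => /eq_mxrowP wB.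
exists w => l ltl; apply/eqP; rewrite mulmxBl subr_eq0 eq_sym; apply/eqP.
have := wB (Ordinal ltl); rewrite /= /B => <-.
by rewrite mulmx_suml; apply: eq_bigr => l' _; rewrite mulmxA.
Qed.

Variable w : forall l, 'M[C]_(N i, N l).
Hypothesis projw : forall l, (l < i)%N -> (G i - lincomb w) *m ctmx (G l) = 0.
Let H := lincomb w.

Lemma proj_gramE : (G i - H) *m ctmx (G i - H) = G i *m ctmx (G i) - H *m ctmx H.
Proof. by apply: gram_proj; apply: lincomb_orth. Qed.

(** [D i] annihilates every earlier [G l], so it remains a right inverse of the residual
    [G i - H]. *)
Lemma posdefmx_residual : posdefmx (G i *m ctmx (G i) - H *m ctmx H).
Proof.
rewrite -proj_gramE; apply: (@posdefmx_gram _ _ _ _ (D i)).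
rewrite mulmxBl frameGD.1 // mulmx_suml big1 ?subr0 // => l _.
by rewrite -mulmxA frameGD.2 ?mulmx0 // ?lt_s // ltn_eqF.
Qed.

(** The projection coefficients [w] are valid elimination coefficients for [det_leadmx_recr], and
    the resulting Schur complement is the Gram matrix of the residual. *)
Lemma det_leadmx_ratio (B : forall j l, 'M[C]_(N j, N l)) :
  (forall j l, (j <= i)%N -> (l <= i)%N -> B j l = G j *m ctmx (G l)) ->
  \det (leadmx B i.+1) / \det (leadmx B i) =
  \det (G i *m ctmx (G i) - H *m ctmx H).
Proof.
move=> BE.
have detB : \det (leadmx B i) != 0.
  rewrite -unitfE -unitmxE; apply/posdefmx_unit/posdefmx_leadmx => j l hj hl.
  by rewrite BE // ltnW.
have GH l : (l < i)%N -> G i *m ctmx (G l) = H *m ctmx (G l).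
  by move=> /projw/eqP; rewrite mulmxBl subr_eq0 => /eqP.
rewrite (@det_leadmx_recr _ _ _ _ w) => [|l ltl]; last first.
  rewrite BE ?GH // ?(ltnW ltl) // mulmx_suml; apply: eq_bigr => j _.
  by rewrite BE ?mulmxA // ltnW.
rewrite mulrC mulKf // BE //; congr (\det (_ - _)).
have HG : H *m ctmx (G i) = H *m ctmx H.
  have : (G i - H) *m ctmx H = 0 by apply: lincomb_orth.
  move=> /(congr1 (@ctmx _ _ _))/eqP; rewrite ctmxM ctmxK ctmx0 ctmxB mulmxBr.
  by rewrite subr_eq0 => /eqP.
rewrite -HG mulmx_suml; apply: eq_bigr => j _.
by rewrite BE ?mulmxA // ltnW.
Qed.

End Projection.
End GramFrame.

Lemma tensmx_sumr (C : nzRingType) (I : finType) m n p q (A : 'M[C]_(m, n))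
    (F : I -> 'M[C]_(p, q)) : A *t (\sum_i F i) = \sum_i (A *t F i).
Proof.
apply/matrixP => a b; rewrite !mxE !summxE mulr_sumr; apply: eq_bigr => i _.
by rewrite mxE.
Qed.

(** * The residual of a Kronecker product of frames *)

Section KroneckerFrame.
Variables (C : numClosedFieldType) (n : nat -> nat -> nat) (M : nat -> nat).
Variables (m s i : nat).
Variables (G : forall p j, 'M[C]_(n j p, M p)) (D : forall p j, 'M[C]_(M p, n j p)).
Variable (w : forall p l, 'M[C]_(n i p, n l p)).
Arguments G : clear implicits.
Arguments D : clear implicits.
Arguments w : clear implicits.
Hypothesis m_gt0 : (0 < m)%N.
Hypothesis lt_is : (i < s)%N.
Hypothesis n_gt0 : forall p, (p < m)%N -> (0 < n i p)%N.
Hypothesis frameGD : forall p, (p < m)%N -> dual_frame (N := fun j => n j p) s (G p) (D p).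

Let H p := lincomb (N := fun j => n j p) (G p) (w p).
Hypothesis projw : forall p l, (p < m)%N -> (l < i)%N ->
  (G p i - H p) *m ctmx (G p l) = 0.

(** The dummy block index lets [kdim kM 0 m] serve as the dimension of the tensor product of the
    ambient spaces. *)
Let kM (_ : nat) p := M p.
Definition kG j : 'M[C]_(kdim n j m, kdim kM 0 m) :=
  ikron (n' := kM) (j' := 0) (fun p => G p j) m.
Definition kD j : 'M[C]_(kdim kM 0 m, kdim n j m) :=
  ikron (n := kM) (j := 0) (fun p => D p j) m.

Lemma dual_frame_ikron : dual_frame (N := fun j => kdim n j m) s kG kD.
Proof.
split=> [j ltj|j l ltj ltl jl]; rewrite ikronM.
  by rewrite -(ikron1 C n j m); apply: eq_ikron => p ltp; rewrite (frameGD ltp).1.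
by apply: (ikron0 m_gt0); rewrite (frameGD m_gt0).2.
Qed.

Lemma kG_gram j l : kG j *m ctmx (kG l) = ikron (fun p => G p j *m ctmx (G p l)) m.
Proof. by rewrite ctmx_ikron ikronM. Qed.

Variable kw : forall l, 'M[C]_(kdim n i m, kdim n l m).
Let kH := lincomb (N := fun j => kdim n j m) kG kw.
Hypothesis projkw : forall l, (l < i)%N -> (kG i - kH) *m ctmx (kG l) = 0.

Let A p := G p i *m ctmx (G p i).
Let X p := H p *m ctmx (H p).
Let W := ikron (n := n) (j := i) (n' := kM) (j' := 0) H m.
(** The tensor product of the projections minus the projection of the tensor product. *)
Let E := W - kH.

Lemma proj_blockE p l : (p < m)%N -> (l < i)%N ->
  G p i *m ctmx (G p l) = H p *m ctmx (G p l).
Proof. by move=> ltp /(projw ltp)/eqP; rewrite mulmxBl subr_eq0 => /eqP. Qed.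

Lemma proj_gram_eq p : (p < m)%N -> G p i *m ctmx (H p) = X p.
Proof.
move=> ltp; apply/eqP; rewrite -subr_eq0 -mulmxBl; apply/eqP.
by apply: lincomb_orth => l ltl; apply: projw.
Qed.

Lemma kron_residual_orth l : (l < i)%N -> (kG i - W) *m ctmx (kG l) = 0.
Proof.
move=> ltl; rewrite mulmxBl kG_gram ctmx_ikron ikronM; apply/eqP.
rewrite subr_eq0; apply/eqP/eq_ikron => p ltp; exact: proj_blockE.
Qed.

Lemma kron_excess_orth l : (l < i)%N -> E *m ctmx (kG l) = 0.
Proof.
move=> ltl; have -> : E = (kG i - kH) - (kG i - W).
  by rewrite opprB addrC addrA subrK.
by rewrite mulmxBl projkw // kron_residual_orth // subr0.
Qed.

Let kH_orth k (Z : 'M[C]_(k, kdim kM 0 m)) :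
  (forall l, (l < i)%N -> Z *m ctmx (kG l) = 0) -> Z *m ctmx kH = 0.
Proof. exact: (@lincomb_orth C (fun j => kdim n j m) _ i kG kw). Qed.

(** [E] is orthogonal to every earlier [kG l], hence to [kH]; orthogonality to [W] then makes it
    orthogonal to itself. *)
Lemma kron_excess_eq0 : E *m ctmx W = 0 -> E = 0.
Proof.
move=> EW; apply: gram_eq0; rewrite {2}/E ctmxB mulmxBr EW sub0r.
have -> : E *m ctmx kH = 0 by apply: kH_orth kron_excess_orth.
by rewrite oppr0.
Qed.

(** Pythagoras for [kG i - kH = (kG i - W) + E]: the first summand is orthogonal to [W] and to [kH],
    hence to [E]. *)
Lemma kron_residual_gram :
  kG i *m ctmx (kG i) - kH *m ctmx kH = (ikron A m - ikron X m) + E *m ctmx E.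
Proof.
have VW : (kG i - W) *m ctmx W = 0.
  rewrite mulmxBl ctmx_ikron !ikronM; apply/eqP; rewrite subr_eq0; apply/eqP.
  exact: eq_ikron proj_gram_eq.
have VE : (kG i - W) *m ctmx E = 0.
  have VH : (kG i - W) *m ctmx kH = 0.
    by apply: kH_orth kron_residual_orth.
  by rewrite /E ctmxB mulmxBr VW VH subrr.
have EV : E *m ctmx (kG i - W) = 0.
  by rewrite -[LHS]ctmxK ctmxM ctmxK VE ctmx0.
rewrite -gram_proj; last exact: kH_orth projkw.
have -> : kG i - kH = (kG i - W) + E by rewrite /E addrA subrK.
rewrite ctmxD mulmxDl !mulmxDr VE EV add0r addr0 gram_proj // kG_gram.
by congr (_ - _ + _); rewrite ctmx_ikron ikronM.
Qed.

Let posA p : (p < m)%N -> posdefmx (A p).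
Proof. by move=> ltp; apply: (@posdefmx_gram _ _ _ _ (D p i)); rewrite (frameGD ltp).1. Qed.

Let psdX p : (p < m)%N -> psdmx (X p).
Proof. by move=> _; apply: psdmx_gram. Qed.

Let posAX p : (p < m)%N -> posdefmx (A p - X p).
Proof.
move=> ltp; apply: (posdefmx_residual (frameGD ltp)) => // l ltl.
exact: projw.
Qed.

Let sigma p := ((\prod_(q < m) n i q) %/ n i p)%N.
Let bound := \prod_(p < m) \det (A p) ^+ sigma p
  - \prod_(p < m) (\det (A p) ^+ sigma p - \det (A p - X p) ^+ sigma p).
Let value := \det (kG i *m ctmx (kG i) - kH *m ctmx kH).

Lemma kron_bound_le : bound <= value.
Proof.
rewrite /value kron_residual_gram.
apply: le_trans (det_posdefmxD _ (psdmx_gram E)).1.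
  exact: det_ikron_sub_ge.
exact: posdefmx_ikron_sub.
Qed.

(** The bound is a chain of two inequalities, through the determinant of [ikron A m - ikron X m].
    Both must be equalities, and the first one forces the Gram matrix of [E] to vanish. *)
Lemma kron_bound_eqP :
  value = bound <-> E = 0 /\ \det (ikron A m - ikron X m) = bound.
Proof.
have pD := posdefmx_ikron_sub n_gt0 posA psdX posAX m_gt0.
rewrite /value kron_residual_gram.
have [leD eqD] := det_posdefmxD pD (psdmx_gram E).
split=> [eqv|[-> eqD0]]; last by rewrite mul0mx addr0.
have eqD0 : \det (ikron A m - ikron X m) = bound.
  apply/eqP; rewrite eq_le; apply/andP; split; last exact: det_ikron_sub_ge.
  by rewrite -eqv.
by split=> //; apply/gram_eq0/eqD; rewrite eqv eqD0.
Qed.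

(** With one factor, [W] is itself a combination of the earlier [kG l], to which [E] is
    orthogonal. *)
Lemma kron_bound_eq_single : m = 1%N -> value = bound.
Proof.
move=> m1; apply/kron_bound_eqP; split; last exact: det_ikron_sub_single.
apply: kron_excess_eq0.
have -> : W = lincomb (N := fun j => kdim n j m) kG (fun l => ikron (fun p => w p l) m).
  rewrite /lincomb; under eq_bigr do rewrite ikronM.
  by rewrite /W m1 /= tensmx_sumr.
exact: (@lincomb_orth C (fun j => kdim n j m) _ i kG _ _ _ kron_excess_orth).
Qed.

Lemma proj_eq0P p : (p < m)%N -> H p = 0 <->
  (forall l, (l < i)%N -> G p l *m ctmx (G p i) = 0 /\ G p i *m ctmx (G p l) = 0).
Proof.
move=> ltp; split=> [H0 l ltl|G0].
  have GG : G p i *m ctmx (G p l) = 0 by rewrite proj_blockE // H0 mul0mx.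
  by split=> //; rewrite -[LHS]ctmxK ctmxM ctmxK GG ctmx0.
by apply/gram_eq0/lincomb_orth => l ltl; rewrite -proj_blockE // (G0 l ltl).2.
Qed.

Lemma kron_bound_eq_proj0 p : (p < m)%N -> H p = 0 -> value = bound.
Proof.
move=> ltp H0; have X0 : X p = 0 by rewrite /X H0 mul0mx.
have W0 : W = 0 by apply: (ikron0 ltp).
apply/kron_bound_eqP; split.
  by apply: kron_excess_eq0; rewrite W0 ctmx0 mulmx0.
rewrite (@ikron0 _ _ _ _ _ X m p) // subr0 (det_ikron_posdef n_gt0 posA) /bound.
(* The [p]-th factor of the subtracted product is zero, so the bound is the determinant of the
   tensor product of the [A p]. *)
by rewrite [X in _ - X](bigD1 (Ordinal ltp)) //= X0 subr0 subrr mul0r subr0.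
Qed.

Lemma kron_bound_eq_collinear i0 : (forall p, (p < m)%N -> n i p = 1%N) ->
  (i0 < i)%N ->
  (forall l p, (l < i)%N -> (p < m)%N -> G p l *m ctmx (G p i) =
     G p l *m ctmx (G p i0) *m invmx (G p i0 *m ctmx (G p i0))
     *m (G p i0 *m ctmx (G p i))) ->
  value = bound.
Proof.
move=> n1 lti0 GE; apply/kron_bound_eqP; split; last exact: det_ikron_sub_dim1.
(* Coefficient of the projection of [G p i] onto the rows of [G p i0] alone. The hypothesis makes it
   agree with the full projection [H p], so that [W] is a multiple of [kG i0]. *)
pose y p := ctmx (invmx (G p i0 *m ctmx (G p i0)) *m (G p i0 *m ctmx (G p i))).
have HE p : (p < m)%N -> H p = y p *m G p i0.
  move=> ltp; apply/eqP; rewrite -subr_eq0; apply/eqP.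
  have Z0 l : (l < i)%N -> (H p - y p *m G p i0) *m ctmx (G p l) = 0.
    move=> ltl; rewrite mulmxBl -proj_blockE //; apply/eqP; rewrite subr_eq0.
    apply/eqP; rewrite -[LHS]ctmxK ctmxM ctmxK GE //.
    by rewrite -2!mulmxA ctmxM [ctmx (ctmx _ *m _)]ctmxM ctmxK.
  apply: gram_eq0; rewrite ctmxB mulmxBr [ctmx (y p *m _)]ctmxM mulmxA Z0 // mul0mx subr0.
  exact: lincomb_orth.
apply: kron_excess_eq0.
have -> : W = ikron y m *m kG i0 by rewrite ikronM; apply: eq_ikron.
by rewrite ctmxM mulmxA kron_excess_orth // mul0mx.
Qed.

(* Testing [W = kH] against the dual vectors of a non-constant index [f] kills
   [kH], so that some coefficient [w p (f p)] vanishes. *)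
Lemma kron_excess0_coef f : E = 0 -> (forall p, (p < m)%N -> (f p < i)%N) ->
  (forall l, (l < i)%N -> exists2 p, (p < m)%N & f p != l) ->
  exists2 p, (p < m)%N & w p (f p) = 0.
Proof.
move=> E0 ltf fN.
pose Df := ikron (n := kM) (j := 0) (n' := fun _ p => n (f p) p) (j' := 0)
  (fun p => D p (f p)) m.
have : W *m Df = 0.
  have -> : W = kH by apply/eqP; rewrite -subr_eq0 -/E E0.
  rewrite mulmx_suml big1 // => l _; have [p ltp fl] := fN l (ltn_ord l).
  rewrite -mulmxA ikronM (ikron0 ltp) ?mulmx0 //.
  by rewrite (frameGD ltp).2 1?eq_sym // (ltn_trans _ lt_is) ?ltf.
rewrite ikronM => /ikron_eq0[p ltp HD]; exists p => //.
by rewrite -[RHS]HD (lincomb_dual (frameGD ltp)) ?ltf.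
Qed.

(** Choose [f p] with [w p (f p)] nonzero. [kron_excess0_coef] forces [f] to be constant; altering
    [f] at a single [p] makes it non-constant, so every other coefficient of [H p] vanishes. *)
Lemma kron_excess0_support : (1 < m)%N -> E = 0 ->
  (forall p, (p < m)%N -> H p != 0) ->
  exists2 i0, (i0 < i)%N & forall p, (p < m)%N -> H p = w p i0 *m G p i0.
Proof.
move=> m_gt1 E0 H0.
have ex p : exists l, (p < m)%N -> (l < i)%N /\ w p l != 0.
  have [ltp|_] := ltnP p m; last by exists 0%N.
  apply: contrapT => /forallNP wN; move: (H0 p ltp); rewrite /H /lincomb big1 ?eqxx //.
  move=> l _; have [->|wl] := eqVneq (w p l) 0; first by rewrite mul0mx.
  by case: (wN l).
pose f p := projT1 (cid (ex p)).
have fP p : (p < m)%N -> (f p < i)%N /\ w p (f p) != 0 := projT2 (cid (ex p)).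
have [lti0 _] := fP 0%N m_gt0; exists (f 0%N) => //.
have fE p : (p < m)%N -> f p = f 0%N.
  move=> ltp; apply: contrapT => /eqP npf.
  case: (@kron_excess0_coef f) => // [q /fP[] //|l ltl|q ltq wq].
    have [<-|] := eqVneq (f 0%N) l; last by exists 0%N.
    by exists p.
  by case: (fP q ltq); rewrite wq eqxx.
have w0 p l : (p < m)%N -> (l < i)%N -> l != f 0%N -> w p l = 0.
  move=> ltp ltl nl.
  (* A second factor, available as [m > 1], keeps the old index and makes the altered choice [g]
     non-constant. *)
  have [q ltq qp] : exists2 q, (q < m)%N & q != p.
    by have [->|np] := eqVneq p 0%N; [exists 1%N | exists 0%N; rewrite 1?eq_sym].
  pose g r := if r == p then l else f r.
  case: (@kron_excess0_coef g) => // [r ltr|l' ltl'|r ltr].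
  - by rewrite /g; case: ifP => // _; case: (fP r ltr).
  - have [<-|nl'] := eqVneq l l'.
      by exists q => //; rewrite /g (negPf qp) fE // eq_sym.
    by exists p; rewrite // /g eqxx.
  rewrite /g; have [-> //|_ wr] := eqVneq r p.
  by case: (fP r ltr); rewrite wr eqxx.
move=> p ltp; rewrite /H /lincomb (bigD1 (Ordinal lti0)) //= big1 ?addr0 // => l nl.
by rewrite w0 ?mul0mx.
Qed.

Lemma kron_bound_eq_cases : (1 < m)%N -> value = bound ->
  (exists2 p, (p < m)%N & H p = 0) \/
  ((forall p, (p < m)%N -> n i p = 1%N) /\
   exists2 i0, (i0 < i)%N & forall p, (p < m)%N -> H p = w p i0 *m G p i0).
Proof.
move=> m_gt1 /kron_bound_eqP[E0 eqD].
have [[p ltp Hp]|/forall2NP HN] := pselect (exists2 p, (p < m)%N & H p = 0).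
  by left; exists p.
have H0 p : (p < m)%N -> H p != 0.
  by move=> ltp; case: (HN p) => // /eqP.
right; split; last exact: kron_excess0_support.
apply: (det_ikron_sub_eq n_gt0 posA psdX posAX) => // p ltp.
by apply: contra (H0 p ltp) => /eqP/gram_eq0 ->.
Qed.

End KroneckerFrame.

(* 0-based indices: blocks i, l < s, matrices p < m; the paper's (A)_i is leadmx _ i.+1 *)
Theorem mainTheorem2 (R : realType) (m s : nat) (n : nat -> nat -> nat)
  (Ab : forall p i j, 'M[R[i]]_(n i p, n j p)) :
  (1 <= m)%N -> (1 <= s)%N ->
  (forall i p, (i < s)%N -> (p < m)%N -> (1 <= n i p)%N) ->
  (forall p, (p < m)%N -> posdefmx (leadmx (N := fun i => n i p) (Ab p) s)) ->
  forall i, (i < s)%N ->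
  let A := khatri_rao Ab m in
  let sigma p := ((\prod_(q < m) n i q) %/ n i p)%N in
  let lhs := \det (leadmx (N := fun j => kdim n j m) A i.+1)
             / \det (leadmx (N := fun j => kdim n j m) A i) in
  let rhs := \prod_(p < m) (\det (Ab p i i)) ^+ sigma p
             - \prod_(p < m) ((\det (Ab p i i)) ^+ sigma p
                 - (\det (leadmx (N := fun j => n j p) (Ab p) i.+1)
                    / \det (leadmx (N := fun j => n j p) (Ab p) i)) ^+ sigma p) in
  rhs <= lhs /\
  (lhs = rhs <->
     ((m = 1%N \/ i = 0%N)
      \/ (exists p, (p < m)%N /\ forall l, (l < i)%N -> Ab p l i = 0 /\ Ab p i l = 0)
      \/ ((forall p, (p < m)%N -> n i p = 1%N) /\
          exists i0, (i0 < i)%N /\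
            forall l p, (l < i)%N -> (p < m)%N ->
              Ab p l i = Ab p l i0 *m invmx (Ab p i0 i0) *m Ab p i0 i))).
Proof.
move=> m_gt0 _ n_pos posA i lt_is A sigma lhs rhs.
have lt_s l : (l <= i)%N -> (l < s)%N by move=> /leq_ltn_trans; apply.
have ltn_s l : (l < i)%N -> (l < s)%N by move=> /ltnW/lt_s.
have exG p : exists F : {M : nat &
      ((forall j, 'M[R[i]]_(n j p, M)) * (forall j, 'M[R[i]]_(M, n j p)))%type},
    (p < m)%N -> dual_frame (N := fun j => n j p) s (tagged F).1 (tagged F).2 /\
    forall j l, (j < s)%N -> (l < s)%N ->
      Ab p j l = (tagged F).1 j *m ctmx ((tagged F).1 l).
  have [ltp|_] := ltnP p m; last first.
    by exists (@existT _ _ 0%N ((fun _ => 0), (fun _ => 0))).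
  have [M [G [D GD]]] := posdefmx_dual_frame (posA p ltp).
  by exists (@existT _ _ M (G, D)).
pose M p := tag (projT1 (cid (exG p))).
pose G p : forall j, 'M[R[i]]_(n j p, M p) := (tagged (projT1 (cid (exG p)))).1.
pose D p : forall j, 'M[R[i]]_(M p, n j p) := (tagged (projT1 (cid (exG p)))).2.
have frameGD p : (p < m)%N -> dual_frame (N := fun j => n j p) s (G p) (D p).
  by move=> /(projT2 (cid (exG p)))[].
have AbE p j l : (p < m)%N -> (j < s)%N -> (l < s)%N -> Ab p j l = G p j *m ctmx (G p l).
  by move=> /(projT2 (cid (exG p)))[_]; apply.
have exw p : exists w : forall l, 'M[R[i]]_(n i p, n l p), forall l,
    (p < m)%N -> (l < i)%N ->
    (G p i - lincomb (N := fun j => n j p) (G p) w) *m ctmx (G p l) = 0.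
  have [ltp|_] := ltnP p m; last by exists (fun _ => 0).
  by have [w wP] := exists_proj (frameGD p ltp) lt_is; exists w => l _; apply: wP.
pose w p := projT1 (cid (exw p)).
have projw p l ltp ltl : (G p i - lincomb (N := fun j => n j p) (G p) (w p))
    *m ctmx (G p l) = 0 := projT2 (cid (exw p)) l ltp ltl.
have frameK := dual_frame_ikron m_gt0 frameGD.
have [kw projkw] := exists_proj frameK lt_is.
have n_gt0 p : (p < m)%N -> (0 < n i p)%N by apply: n_pos.
pose H p := lincomb (N := fun j => n j p) (G p) (w p).
pose kH := lincomb (N := fun j => kdim n j m) (kG m G) kw.
have lhsE : lhs = \det (kG m G i *m ctmx (kG m G i) - kH *m ctmx kH).
  apply: (det_leadmx_ratio frameK lt_is projkw) => j l lej lel.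
  rewrite kG_gram /A /khatri_rao kron_blk_ikron.
  by apply: eq_ikron => p ltp; rewrite AbE ?lt_s.
have rhsE : rhs = \prod_(p < m) \det (G p i *m ctmx (G p i)) ^+ sigma p
  - \prod_(p < m) (\det (G p i *m ctmx (G p i)) ^+ sigma p
      - \det (G p i *m ctmx (G p i) - H p *m ctmx (H p)) ^+ sigma p).
  rewrite /rhs; congr (_ - _); first by apply: eq_bigr => p _; rewrite -AbE.
  apply: eq_bigr => p _; have ltp := ltn_ord p.
  rewrite -AbE //; congr (_ - _ ^+ _); rewrite AbE //.
  apply: (det_leadmx_ratio (frameGD p ltp) lt_is (fun l => projw p l ltp)) => j l lej lel.
  by rewrite AbE ?lt_s.
rewrite lhsE rhsE; split; first exact: (kron_bound_le m_gt0 lt_is n_gt0 frameGD projw projkw).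
split=> [eqv|].
  have [m1|m_neq1] := eqVneq m 1%N; first by left; left.
  have m_gt1 : (1 < m)%N by rewrite ltn_neqAle eq_sym m_neq1.
  right; have := kron_bound_eq_cases m_gt0 lt_is n_gt0 frameGD projw projkw m_gt1 eqv.
  case=> [[p ltp H0]|[n1 [i0 lti0 HE]]]; [left | right].
    exists p; split=> // l ltl; rewrite !AbE // ?ltn_s //.
    by move/(proj_eq0P projw ltp): H0; apply.
  split=> //; exists i0; split=> // l p ltl ltp.
  have GE l' : (l' < i)%N -> G p l' *m ctmx (G p i) = G p l' *m ctmx (H p).
    move=> ltl'; rewrite -[LHS]ctmxK ctmxM ctmxK (proj_blockE projw) //.
    by rewrite ctmxM ctmxK.
  rewrite !AbE // ?ltn_s // !GE // /H HE // ctmxM.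
  rewrite (mulmxA (G p i0)); set S := G p i0 *m ctmx (G p i0).
  (* Since [H p] equals [w p i0 *m G p i0], the factor [S] cancels against its inverse and both
     sides become [G p l *m ctmx (G p i0) *m ctmx (w p i0)]. *)
  suff uS : S \in unitmx by rewrite -(mulmxA _ (invmx S)) mulKmx // mulmxA.
  exact/posdefmx_unit/posdefmx_gram/(frameGD p ltp).1/ltn_s.
case=> [[m1|i_eq0]|[[p [ltp Ab0]]|[n1 [i0 [lti0 AbC]]]]].
- exact: (kron_bound_eq_single m_gt0 lt_is n_gt0 frameGD projw projkw).
(* For [i = 0] there are no earlier blocks, so the projection for [p = 0] vanishes. *)
- apply: (kron_bound_eq_proj0 m_gt0 lt_is n_gt0 frameGD projw projkw m_gt0).
  by apply/(proj_eq0P projw m_gt0) => l; rewrite i_eq0.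
- apply: (kron_bound_eq_proj0 m_gt0 lt_is n_gt0 frameGD projw projkw ltp).
  apply/(proj_eq0P projw ltp) => l ltl; rewrite -!AbE // ?ltn_s //.
  exact: Ab0.
apply: (kron_bound_eq_collinear m_gt0 lt_is n_gt0 frameGD projw projkw n1 lti0).
by move=> l p ltl ltp; rewrite -!AbE // ?ltn_s // AbC.
Qed.
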